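(* Let $n=p+q$ be an odd positive integer, let $V$ be an $r$-dimensional Euclidean space, let $\Omega\subset V$ be an open domain (nonempty connected open set), and let $k\ge 0$ be an integer. Let $h^a=h^a(x)$ and $g^a=g^a(x)$, $a=1,\dots,n$, be functions $\Omega\to\mathcal{C}\ell^{\mathbb{R}}(p,q)$ of class $C^k(\Omega)$ such that for all $a,b=1,\dots,n$ and all $x\in\Omega$ $$h^a(x)h^b(x)+h^b(x)h^a(x)=2\eta^{ab}e,\qquad g^a(x)g^b(x)+g^b(x)g^a(x)=2\eta^{ab}e .$$ Put $h^{1\ldots n}:=h^1(x)h^2(x)\cdots h^n(x)$ and $g^{1\ldots n}:=g^1(x)g^2(x)\cdots g^n(x)$ (these do not depend on $x$). Then for any point $x_0\in\Omega$ there exist $\varepsilon>0$ with $O_\varepsilon(x_0)\subset\Omega$ and a function $T=T(x):O_\varepsilon(x_0)\to\mathcal{C}\ell^{\mathbb{R}}(p,q)$ such that: 1. $T$ is of class $C^k(O_\varepsilon(x_0))$; 2. $T(x)$ is an invertible element of $\mathcal{C}\ell^{\mathbb{R}}(p,q)$ for every $x\in O_\varepsilon(x_0)$; 3. the following equivalences hold, where each left-hand equality is understood for all $a=1,\dots,n$ and all $x\in O_\varepsilon(x_0)$: (a) $g^a(x)=T^{-1}(x)h^a(x)T(x)\ \Leftrightarrow\ h^{1\ldots n}=g^{1\ldots n}$; (b) $g^a(x)=-T^{-1}(x)h^a(x)T(x)\ \Leftrightarrow\ h^{1\ldots n}=-g^{1\ldots n}$; (c) $g^a(x)=e^{1\ldots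 n}T^{-1}(x)h^a(x)T(x)\ \Leftrightarrow\ h^{1\ldots n}=e^{1\ldots n}g^{1\ldots n}$; (d) $g^a(x)=-e^{1\ldots n}T^{-1}(x)h^a(x)T(x)\ \Leftrightarrow\ h^{1\ldots n}=-e^{1\ldots n}g^{1\ldots n}$; 4. the function $T$ (with properties 1–3 on $O_\varepsilon(x_0)$) is defined up to multiplication by $\lambda(x)e+\nu(x)e^{1\ldots n}$, where $\lambda,\nu$ are real functions of class $C^k(O_\varepsilon(x_0))$ such that $\lambda(x)e+\nu(x)e^{1\ldots n}$ is invertible at every point of $O_\varepsilon(x_0)$.
   Context: $\mathcal{C}\ell^{\mathbb{R}}(p,q)$, $n=p+q$, is the real Clifford algebra with identity $e$ and generators $e^1,\dots,e^n$ satisfying $e^ae^b+e^be^a=2\eta^{ab}e$, where $\eta=\|\eta^{ab}\|$ is the diagonal matrix with $p$ entries $1$ followed by $q$ entries $-1$. It has dimension $2^n$, with basis $e^{a_1\ldots a_k}:=e^{a_1}\cdots e^{a_k}$, $a_1<\dots<a_k$, $0\le k\le n$ (the empty product being $e$); in particular $e^{1\ldots n}=e^1\cdots e^n$. A function into $\mathcal{C}\ell^{\mathbb{R}}(p,q)$ is of class $C^k$ if all its real coordinate functions with respect to this fixed basis have continuous partial derivatives up to order $k$ ($C^0$ means continuous). $O_\varepsilon(x_0)=\{x\in V:\|x-x_0\|<\varepsilon\}$. Under the stated hypotheses the products $h^{1\ldots n}$ and $g^{1\ldots n}$ do not depend on $x$, and each equals $\pm e^{1\ldots n}$ or $\pm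 e$ (the latter only if $p-q\equiv 1 \bmod 4$); hence one of the four right-hand conditions in item 3 always holds. *)

(* Defs.v *)
(* MathComp + MathComp-Analysis. *)
From HB Require Import structures.
From mathcomp Require Import all_boot all_order all_algebra all_field.
From mathcomp Require Import all_classical all_reals all_analysis.
From mathcomp Require Import ring.

Set Implicit Arguments.
Unset Strict Implicit.
Unset Printing Implicit Defensive.

Import Order.TTheory GRing.Theory Num.Theory.
Import numFieldNormedType.Exports.

Local Open Scope classical_set_scope.
Local Open Scope ring_scope.

Section Clifford.
Variables (R : fieldType) (p q : nat).

Definition eta : 'M[R]_(p + q) :=
  diag_mx (\row_i (if (i < p)%N then 1 else -1)).

(* An element is its family of coordinates in the basis (e^A), where A ranges
   over the subsets of {0, ..., p+q-1} and e^A is the product of the generators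
   e^i, i \in A, in increasing order (see [cl_basisE] and [cl_coordE]). *)
Definition clifford : Type := {ffun {set 'I_(p + q)} -> R^o}.

HB.instance Definition _ := Vector.on clifford.

Definition cl_coord (u : clifford) (A : {set 'I_(p + q)}) : R :=
  fun_of_fin u A.

Definition cl_basis (A : {set 'I_(p + q)}) : clifford :=
  [ffun B => (B == A)%:R].

Definition setsym (A B : {set 'I_(p + q)}) : {set 'I_(p + q)} :=
  [set i | (i \in A) (+) (i \in B)].

(* e^A * e^B = cl_sign A B *: e^(A symdiff B): reordering costs a sign for
   every i \in A, j \in B with j < i, and every i in both A and B contributes
   the square eta i i of e^i. *)
Definition cl_sign (A B : {set 'I_(p + q)}) : R :=
  \prod_(i in A) \prod_(j in B)
    (if i == j then eta i i else (-1) ^+ (j < i)%N).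

Definition cl_mul (u v : clifford) : clifford :=
  [ffun C => \sum_A cl_sign A (setsym A C)
                    * cl_coord u A * cl_coord v (setsym A C)].

Lemma clP (u v : clifford) : cl_coord u =1 cl_coord v -> u = v.
Proof. by move=> uv; apply/ffunP => A; exact: uv. Qed.

Lemma cl_coordD u v A : cl_coord (u + v) A = cl_coord u A + cl_coord v A.
Proof. by rewrite /cl_coord ffunE. Qed.

Lemma cl_coordZ c u A : cl_coord (c *: u) A = c * cl_coord u A.
Proof. by rewrite /cl_coord ffunE. Qed.

Lemma cl_coord_mul u v C : cl_coord (cl_mul u v) C =
  \sum_A cl_sign A (setsym A C) * cl_coord u A * cl_coord v (setsym A C).
Proof. by rewrite /cl_coord ffunE. Qed.

Lemma cl_coord_basis A B : cl_coord (cl_basis A) B = (B == A)%:R.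
Proof. by rewrite /cl_coord ffunE. Qed.

Lemma setsymA : associative setsym.
Proof. by move=> A B C; apply/setP => i; rewrite !inE addbA. Qed.

Lemma setsymC : commutative setsym.
Proof. by move=> A B; apply/setP => i; rewrite !inE addbC. Qed.

Lemma setsymK A : involutive (setsym A).
Proof. by move=> B; apply/setP => i; rewrite !inE addbA addbb addFb. Qed.

Lemma setsym0 A : setsym A finset.set0 = A.
Proof. by apply/setP => i; rewrite !inE addbF. Qed.

Lemma set0sym A : setsym finset.set0 A = A.
Proof. by rewrite setsymC setsym0. Qed.

Lemma setsymv A : setsym A A = finset.set0.
Proof. by apply/setP => i; rewrite !inE addbb. Qed.

Lemma eta_sq i : eta i i * eta i i = 1.
Proof. by rewrite !mxE eqxx mulr1n; case: ifP; rewrite ?mulrNN mulr1. Qed.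

Lemma prod_setsym (F : 'I_(p + q) -> R) A B : (forall i, F i * F i = 1) ->
  \prod_(i in setsym A B) F i = (\prod_(i in A) F i) * \prod_(i in B) F i.
Proof.
move=> F1; rewrite big_mkcond [in RHS]big_mkcond /=.
rewrite [X in _ * X]big_mkcond -big_split /=.
apply: eq_bigr => i _; rewrite !inE.
by case: (i \in A); case: (i \in B); rewrite ?F1 ?mulr1 ?mul1r.
Qed.

Lemma cl_swap_sq (i j : 'I_(p + q)) :
  (if i == j then eta i i else (-1) ^+ (j < i)%N) *
  (if i == j then eta i i else (-1) ^+ (j < i)%N) = 1 :> R.
Proof. by case: eqP => _; rewrite ?eta_sq // -signr_addb addbb. Qed.

Lemma cl_sign_symr A B C :
  cl_sign A (setsym B C) = cl_sign A B * cl_sign A C.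
Proof.
rewrite /cl_sign -big_split; apply: eq_bigr => i _ /=.
by rewrite prod_setsym // => j; exact: cl_swap_sq.
Qed.

Lemma cl_sign_syml A B C :
  cl_sign (setsym A B) C = cl_sign A C * cl_sign B C.
Proof.
rewrite /cl_sign prod_setsym // => i; rewrite -big_split big1 //= => j _.
exact: cl_swap_sq.
Qed.

Lemma cl_sign0l A : cl_sign finset.set0 A = 1.
Proof. by rewrite /cl_sign big_set0. Qed.

Lemma cl_sign0r A : cl_sign A finset.set0 = 1.
Proof. by rewrite /cl_sign big1 // => i _; rewrite big_set0. Qed.

Lemma cl_mulA : associative cl_mul.
Proof.
move=> u v w; apply: clP => D; rewrite !cl_coord_mul.
under eq_bigr do rewrite cl_coord_mul mulr_sumr.
under [RHS]eq_bigr do rewrite cl_coord_mul mulr_sumr mulr_suml.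
rewrite [RHS]exchange_big /=; apply: eq_bigr => A _.
rewrite [RHS](reindex_inj (can_inj (setsymK A))); apply: eq_bigr => B _ /=.
rewrite setsymK -setsymA setsymA [setsym B A]setsymC -!setsymA.
rewrite cl_sign_syml.
have -> : setsym A (setsym B D) = setsym B (setsym A D).
  by rewrite !setsymA [setsym A B]setsymC.
have {1}-> : setsym A D = setsym B (setsym B (setsym A D)) by rewrite setsymK.
rewrite cl_sign_symr; ring.
Qed.

Lemma cl_mul1 : left_id (cl_basis finset.set0) cl_mul.
Proof.
move=> u; apply: clP => C; rewrite cl_coord_mul (bigD1 finset.set0) //=.
rewrite big1 ?addr0 => [|A /negPf A0]; last first.
  by rewrite cl_coord_basis A0 mulr0 mul0r.
by rewrite cl_coord_basis eqxx set0sym cl_sign0l !mul1r.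
Qed.

Lemma cl_mulr1 : right_id (cl_basis finset.set0) cl_mul.
Proof.
move=> u; apply: clP => C; rewrite cl_coord_mul (bigD1 C) //=.
rewrite big1 ?addr0 => [|A /negPf AC]; last first.
  rewrite cl_coord_basis; case: eqP => [E|_]; last by rewrite mulr0.
  by move: AC; rewrite -[C](setsymK A) E setsym0 eqxx.
by rewrite setsymv cl_sign0r cl_coord_basis eqxx mul1r mulr1.
Qed.

Lemma cl_mulDl : left_distributive cl_mul +%R.
Proof.
move=> u v w; apply: clP => C; rewrite cl_coordD !cl_coord_mul -big_split.
by apply: eq_bigr => A _ /=; rewrite cl_coordD mulrDr mulrDl.
Qed.

Lemma cl_mulDr : right_distributive cl_mul +%R.
Proof.
move=> u v w; apply: clP => C; rewrite cl_coordD !cl_coord_mul -big_split.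
by apply: eq_bigr => A _ /=; rewrite cl_coordD mulrDr.
Qed.

Lemma cl_1neq0 : cl_basis finset.set0 != 0 :> clifford.
Proof.
apply/eqP => /(congr1 (cl_coord ^~ finset.set0)) /eqP.
by rewrite cl_coord_basis /cl_coord ffunE !eqxx oner_eq0.
Qed.

HB.instance Definition _ := GRing.Zmodule_isNzRing.Build clifford
  cl_mulA cl_mul1 cl_mulr1 cl_mulDl cl_mulDr cl_1neq0.

Lemma cl_scaleAl (c : R) (u v : clifford) : c *: (u * v) = (c *: u) * v.
Proof.
apply: clP => C; rewrite cl_coordZ !cl_coord_mul mulr_sumr.
by apply: eq_bigr => A _ /=; rewrite cl_coordZ; ring.
Qed.

HB.instance Definition _ := GRing.Lmodule_isLalgebra.Build R clifford cl_scaleAl.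

Lemma cl_scaleAr (c : R) (u v : clifford) : c *: (u * v) = u * (c *: v).
Proof.
apply: clP => C; rewrite cl_coordZ !cl_coord_mul mulr_sumr.
by apply: eq_bigr => A _ /=; rewrite cl_coordZ; ring.
Qed.

HB.instance Definition _ := GRing.Lalgebra_isAlgebra.Build R clifford cl_scaleAr.
HB.instance Definition _ := Algebra_isFalgebra.Build R clifford.

Definition cl_gen (a : 'I_(p + q)) : clifford := cl_basis [set a]%SET.

Definition cl_top : clifford := \prod_(a < p + q) cl_gen a.

Lemma cl_basisM A B :
  cl_basis A * cl_basis B = cl_sign A B *: cl_basis (setsym A B).
Proof.
apply: clP => C; rewrite cl_coordZ cl_coord_mul (bigD1 A) //=.
rewrite big1 ?addr0 => [|D /negPf AD]; last first.
  by rewrite cl_coord_basis AD mulr0 mul0r.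
rewrite !cl_coord_basis eqxx mulr1.
have -> : (setsym A C == B) = (C == setsym A B).
  by apply/eqP/eqP => [<-|->]; rewrite setsymK.
by case: eqP => [->|]; rewrite ?mulr0 // setsymK.
Qed.

Lemma cl_genM (a b : 'I_(p + q)) :
  cl_gen a * cl_gen b + cl_gen b * cl_gen a = (2 * eta a b)%:A.
Proof.
rewrite /cl_gen !cl_basisM /cl_sign !big_set1 [b == a]eq_sym setsymC.
rewrite -scalerDl; have [<-|ab] := eqVneq a b.
  by rewrite setsymv -mulr2n mulr_natl.
rewrite [eta a b]mxE (negPf ab) mulr0n mulr0 scale0r.
suff -> : (-1) ^+ (b < a)%N + (-1) ^+ (a < b)%N = 0 :> R by rewrite scale0r.
case: ltngtP => [_|_|/val_inj ba]; rewrite ?expr0 ?expr1 ?subrr ?addNr //.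
by rewrite ba eqxx in ab.
Qed.

Lemma cl_basisE A : cl_basis A = \prod_(a in A) cl_gen a.
Proof.
rewrite -big_filter; set s := seq.filter _ _.
have : sorted (fun i j : 'I_(p + q) => i < j)%N s.
  apply: sorted_filter => [y x z /ltn_trans|]; first exact.
  have := iota_ltn_sorted 0 (p + q).
  by rewrite -val_enum_ord sorted_map enumT [index_enum _]unlock.
have -> : A = [set a in s]%SET.
  by apply/setP => a; rewrite inE mem_filter mem_index_enum andbT.
elim: s => [_|a s IH].
  by rewrite big_nil; congr cl_basis; apply/setP => a; rewrite !inE.
move=> /= sas; rewrite big_cons -IH ?(path_sorted sas) // /cl_gen cl_basisM.
have /allP als : all (fun j : 'I_(p + q) => a < j)%N s.
  by apply: order_path_min sas => y x z /ltn_trans; apply.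
rewrite /cl_sign big_set1 big1 ?scale1r => [|j]; last first.
  by rewrite inE => /als aj; rewrite ltnNge (ltnW aj) -val_eqE ltn_eqF.
congr cl_basis; apply/setP => j; rewrite !inE.
by case: eqP => //= ->; case: (boolP (a \in s)) => // /als; rewrite ltnn.
Qed.

Lemma cl_topE : cl_top = cl_basis [set: 'I_(p + q)]%SET.
Proof. by rewrite cl_basisE; apply: eq_bigl => a; rewrite inE. Qed.

Lemma cl_coordE (u : clifford) : u = \sum_A cl_coord u A *: cl_basis A.
Proof.
apply/ffunP => B; rewrite sum_ffunE (bigD1 B) //= big1 ?addr0 => [|A AB].
  by rewrite !ffunE eqxx /GRing.scale /= mulr1.
by rewrite !ffunE eq_sym (negPf AB) scaler0.
Qed.

End Clifford.

Arguments cl_top {R p q}.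
Arguments cl_gen {R p q} a.
Arguments eta {R p q}.

Section Regularity.
Variables (R : realType) (r : nat).

(* The Euclidean ball: the library norm on row vectors is the sup norm, which
   defines the same topology. *)
Definition eball (x0 : 'rV[R]_r) (eps : R) : set 'rV[R]_r :=
  [set x | Num.sqrt (\sum_i (x 0 i - x0 0 i) ^+ 2) < eps].

(* Meant for U open: the partial derivatives at points of U then depend only on
   the restriction of f to U. *)
Fixpoint class_C (k : nat) (U : set 'rV[R]_r) (f : 'rV[R]_r -> R) : Prop :=
  (forall x, U x -> {for x, continuous f}) /\
  if k is k'.+1 then
    forall i : 'I_r, (forall x, U x -> derivable f x (delta_mx 0 i)) /\
      class_C k' U ('D_(delta_mx 0 i) f)
  else True.

Variables (p q : nat).
Local Notation Cl := (clifford R p q).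

Definition cl_class_C (k : nat) (U : set 'rV[R]_r) (F : 'rV[R]_r -> Cl) : Prop :=
  forall A, class_C k U (fun x => cl_coord (F x) A).

(* Properties 1-3 of T on the open set U; H and G are the constant values of
   the products of the h a and of the g a. *)
Definition intertwines (k : nat) (U : set 'rV[R]_r)
    (h g : 'I_(p + q) -> 'rV[R]_r -> Cl) (H G : Cl) (T : 'rV[R]_r -> Cl) : Prop :=
  [/\ cl_class_C k U T,
      (forall x, U x -> T x \is a GRing.unit) &
      [/\ (forall a x, U x -> g a x = (T x)^-1 * h a x * T x)
            <-> H = G,
          (forall a x, U x -> g a x = - ((T x)^-1 * h a x * T x))
            <-> H = - G,
          (forall a x, U x -> g a x = cl_top * (T x)^-1 * h a x * T x)
            <-> H = cl_top * G &
          (forall a x, U x -> g a x = - (cl_top * (T x)^-1 * h a x * T x))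
            <-> H = - (cl_top * G)]].

End Regularity.

(* Main.v *)
(* Write [h^A] for the ordered product of the [h^a], [a] in [A], and [n] for the
   number of generators.  For any [F] the average [T = sum_A h^A F (g^A)^-1]
   satisfies [h^a T = T g^a], so everything rests on choosing [F] such that [T]
   is invertible.

   Since [n] is odd, the center [Z] is spanned by [e] and [e^{1..n}].  The
   coordinate at [e] is a trace and vanishes on elements anticommuting with some
   [h^a]; hence the [h^A] with [#|A|] even are independent over [Z], and by
   counting dimensions they span the algebra over [Z].  So an element commuting
   with all [h^a] is central.  In particular [h^{1..n}] is central, its ratio [c]
   to [g^{1..n}] has square [e], and this forces [c] to be [+-e] or
   [+-e^{1..n}].  Replacing [g] by [c g] we may assume [h^{1..n} = g^{1..n}].

   Let [Q(K) = sum_A g^A K (h^A)^-1].  Then [T(F) Q(K)] is central, and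
   [sum_B Q(e^B) (e^B)^-1 = 2^(n+1) e] shows that these products do not all vanish
   in any of the (at most two) simple factors of the algebra, so [T(F) Q(K) = e]
   for some [F] and [K] at the given point.  Letting [h] and [g] vary with [x],
   [T(F) Q(K) = a(x) e + b(x) e^{1..n}] remains invertible near that point. *)
From HB Require Import structures.
Require Import Defs.
From mathcomp Require Import all_boot all_order all_algebra all_field.
From mathcomp Require Import all_classical all_reals all_analysis.
From mathcomp Require Import ring lra.

Set Implicit Arguments.
Unset Strict Implicit.
Unset Printing Implicit Defensive.

Import Order.TTheory GRing.Theory Num.Theory.
Import numFieldNormedType.Exports.

Local Open Scope classical_set_scope.
Local Open Scope ring_scope.

(** * Systems satisfying the Clifford relations *)

Section System.
Variables (R : fieldType) (p q : nat).
Local Notation Cl := (clifford R p q).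

Definition clifford_system (h : 'I_(p + q) -> Cl) : Prop :=
  forall a b, h a * h b + h b * h a = (2 * eta a b)%:A.

Definition hprod (h : 'I_(p + q) -> Cl) (A : {set 'I_(p + q)}) : Cl :=
  \prod_(a in A) h a.

Lemma cl_gen_system : clifford_system cl_gen.
Proof. by move=> a b; rewrite cl_genM. Qed.

Lemma hprod_gen (A : {set 'I_(p + q)}) : hprod cl_gen A = cl_basis R A.
Proof. by rewrite cl_basisE. Qed.

Lemma cl_sign_sqr (A B : {set 'I_(p + q)}) :
  cl_sign R A B * cl_sign R A B = 1 :> R.
Proof. by rewrite -cl_sign_symr setsymv cl_sign0r. Qed.

Lemma sym1_notin (a : 'I_(p + q)) (A : {set 'I_(p + q)}) :
  a \in A -> a \notin setsym [set a]%SET A.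
Proof. by move=> aA; rewrite !inE eqxx aA. Qed.

Section OneSystem.
Variables (h : 'I_(p + q) -> Cl).
Hypothesis two_neq0 : 2 != 0 :> R.
Hypothesis h_sys : clifford_system h.

Lemma system_sq a : h a * h a = (eta a a)%:A.
Proof.
have := h_sys a a; rewrite -mulr2n -scaler_nat.
move=> /(congr1 (fun u => 2^-1 *: u)).
by rewrite !scalerA mulVf // scale1r mulrA mulVf // mul1r.
Qed.

Lemma system_anti a b : a != b -> h a * h b = - (h b * h a).
Proof.
move=> ab; apply/eqP; rewrite -subr_eq0 opprK h_sys.
by rewrite [eta a b]mxE (negPf ab) mulr0n mulr0 scale0r.
Qed.

Lemma hprod0 : hprod h finset.set0 = 1.
Proof. by rewrite /hprod big_set0. Qed.

(** Induction along the increasing enumeration. A head [j] other than [a] precedes [a], so [h a]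
    passes [h j] with a sign exactly when [j \in A]; at [a] itself it is inserted, or squares to
    [eta a a]. *)
Lemma hprod_mull a A :
  h a * hprod h A = cl_sign R [set a]%SET A *: hprod h (setsym [set a]%SET A).
Proof.
rewrite /hprod /cl_sign big_set1.
have : sorted (fun i j : 'I_(p + q) => i < j)%N (index_enum 'I_(p + q)).
  have := iota_ltn_sorted 0 (p + q).
  by rewrite -val_enum_ord sorted_map enumT [index_enum _]unlock.
have : a \in index_enum 'I_(p + q) by rewrite mem_index_enum.
elim: (index_enum _) => // j s IH; rewrite in_cons => /orP ajs js.
have /allP jlt : all (fun i : 'I_(p + q) => j < i)%N s.
  by apply: order_path_min js => y x z /ltn_trans; apply.
have {}IH := IH _ (path_sorted js).
rewrite !big_cons !inE; have [ja|ja] := eqVneq j a.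
  have tl : \prod_(i <- s | i \in setsym [set a]%SET A) h i
          = \prod_(i <- s | i \in A) h i.
    rewrite big_seq_cond [RHS]big_seq_cond; apply: eq_bigl => i.
    by rewrite !inE; case: (boolP (i \in s)) => //= /jlt; rewrite ja => ai;
      rewrite -val_eqE /= gtn_eqF.
  have ts : \prod_(i <- s | i \in A)
      (if a == i then eta a a else (-1) ^+ (i < a)%N) = 1 :> R.
    rewrite big_seq_cond big1 // => i /andP[/jlt]; rewrite ja => ai _.
    by rewrite -val_eqE /= ltn_eqF // ltnNge (ltnW ai).
  rewrite ja tl ts; case: (boolP (a \in A)) => /= aA.
    by rewrite mulrA system_sq -scalerAl mul1r mulr1.
  by rewrite scale1r.
have {}IH : h a * (\prod_(i <- s | i \in A) h i) =
   \prod_(j <- s | j \in A) (if a == j then eta a a else (-1) ^+ (j < a)%N)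
   *: \prod_(a0 <- s | a0 \in setsym [set a]%SET A) h a0.
  by apply: IH; case: ajs => // /eqP aj; rewrite aj eqxx in ja.
have -> /= : (j < a)%N.
  by apply: jlt; case: ajs => // /eqP aj; rewrite aj eqxx in ja.
case: (boolP (j \in A)) => jA /=; last exact: IH.
rewrite expr1 mulrA system_anti 1?eq_sym //.
by rewrite mulNr -mulrA IH -scalerAr mulN1r scaleNr.
Qed.

(** Induction on the size of [A], splitting off one generator; the signs combine because [cl_sign]
    is multiplicative in each argument. Every system thus multiplies like the basis. *)
Lemma hprodM A B :
  hprod h A * hprod h B = cl_sign R A B *: hprod h (setsym A B).
Proof.
have [m] := ubnP #|A|; elim: m => // m IH in A *; rewrite ltnS => Am.
have [->|[a aA]] := set_0Vmem A.
  by rewrite hprod0 mul1r cl_sign0l scale1r set0sym.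
set A' := setsym [set a]%SET A.
have AE : A = setsym [set a]%SET A' by rewrite setsymK.
have A'm : (#|A'| < m)%N.
  apply: leq_trans Am; apply: proper_card; apply/fintype.properP; split.
    apply/fintype.subsetP => i; rewrite !inE.
    by case: eqP => [->|]; rewrite ?aA.
  by exists a => //; exact: sym1_notin.
have hA : hprod h A = cl_sign R [set a]%SET A' *: (h a * hprod h A').
  by rewrite hprod_mull -AE scalerA cl_sign_sqr scale1r.
rewrite hA -scalerAl -mulrA IH // -scalerAr hprod_mull !scalerA.
rewrite [in RHS]AE -setsymA; congr (_ *: _).
rewrite cl_sign_syml cl_sign_symr.
by rewrite mulrACA cl_sign_sqr mul1r mulrC.
Qed.

Lemma hprod_sq A : hprod h A * hprod h A = (cl_sign R A A)%:A.
Proof. by rewrite hprodM setsymv hprod0. Qed.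

Lemma hprod1 a : hprod h [set a]%SET = h a.
Proof. by rewrite /hprod big_set1. Qed.

Lemma hprod_comm1 a A :
  hprod h A * h a = (-1) ^+ #|(A :\ a)%SET| *: (h a * hprod h A).
Proof.
rewrite -hprod1 !hprodM scalerA setsymC; congr (_ *: _).
(* Each [i \in A] other than [a] is an inversion in exactly one of the two orders and contributes
   -1; [i = a] contributes the square of [eta a a]. *)
have -> : (-1) ^+ #|(A :\ a)%SET|
    = cl_sign R A [set a]%SET * cl_sign R [set a]%SET A.
  rewrite /cl_sign big_set1.
  under eq_bigr do rewrite big_set1.
  rewrite -big_split /= (bigID (pred1 a)) /=.
  rewrite big1 ?mul1r => [|i /andP[_ /eqP->]]; last by rewrite eqxx eta_sq.
  rewrite -prodr_const; apply: eq_big => i; rewrite ?inE 1?andbC //.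
  move=> /andP[_ ia]; rewrite (negPf ia) eq_sym (negPf ia) -signr_addb.
  by move: ia; rewrite -val_eqE /=; case: ltngtP.
by rewrite -mulrA cl_sign_sqr mulr1.
Qed.

End OneSystem.
End System.

(** * The trace and the center for an odd number of generators *)

Section Center.
Variables (R : realFieldType) (p q : nat).
Let two_neq0 : 2 != 0 :> R. Proof. by rewrite pnatr_eq0. Qed.
Hypothesis n_odd : odd (p + q).
Local Notation Cl := (clifford R p q).
Local Notation e0 := (@finset.set0 'I_(p + q)).
Local Notation eT := [set: 'I_(p + q)]%SET.
Local Notation s := (@cl_sign R p q eT eT).

Implicit Types (h g : 'I_(p + q) -> Cl) (A B : {set 'I_(p + q)}).

Definition cl_pair (a b : R) : Cl := a *: 1 + b *: cl_top.

Definition central (c : Cl) : Prop := forall u, c * u = u * c.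

Lemma cl_coord_sum I (r : seq I) (P : pred I) (F : I -> Cl) A :
  cl_coord (\sum_(i <- r | P i) F i) A = \sum_(i <- r | P i) cl_coord (F i) A.
Proof.
elim/big_rec2: _ => [|i x y _ <-]; first by rewrite /cl_coord ffunE.
exact: cl_coordD.
Qed.

(* [tau] in a lemma name stands for the coordinate at [e], which is a trace. *)
Lemma tau_mul (u v : Cl) :
  cl_coord (u * v) e0 = \sum_A cl_sign R A A * cl_coord u A * cl_coord v A.
Proof. by rewrite cl_coord_mul; apply: eq_bigr => A _; rewrite setsym0. Qed.

Lemma tauC (u v : Cl) : cl_coord (u * v) e0 = cl_coord (v * u) e0.
Proof. by rewrite !tau_mul; apply: eq_bigr => A _; ring. Qed.

Lemma tau_basis A (u : Cl) :
  cl_coord (cl_basis R A * u) e0 = cl_sign R A A * cl_coord u A.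
Proof.
rewrite tau_mul (bigD1 A) //= cl_coord_basis eqxx mulr1 big1 ?addr0 //.
by move=> B /negPf BA; rewrite cl_coord_basis BA mulr0 mul0r.
Qed.

Lemma tau1 : cl_coord (1 : Cl) e0 = 1.
Proof. by rewrite cl_coord_basis eqxx. Qed.

Lemma setT_neq0 : (eT == e0) = false.
Proof.
apply/negbTE/eqP => /(congr1 (fun A : {set _} => #|A|)).
by rewrite cardsT card_ord cards0 => n0; move: n_odd; rewrite n0.
Qed.

Lemma tau_top : cl_coord (cl_top : Cl) e0 = 0.
Proof. by rewrite cl_topE cl_coord_basis eq_sym setT_neq0. Qed.

Lemma cl_pair_coord0 a b : cl_coord (cl_pair a b) e0 = a.
Proof. by rewrite cl_coordD !cl_coordZ tau1 tau_top mulr0 mulr1 addr0. Qed.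

Lemma cl_pair_coordT a b : cl_coord (cl_pair a b) eT = b.
Proof.
rewrite cl_coordD !cl_coordZ cl_topE !cl_coord_basis eqxx setT_neq0.
by rewrite mulr0 mulr1 add0r.
Qed.

Lemma hprod_setT h : hprod h eT = \prod_(a < p + q) h a.
Proof. by apply: eq_bigl => a; rewrite inE. Qed.

Lemma cl_top_hprod : cl_top = hprod cl_gen eT :> Cl.
Proof. by rewrite hprod_setT. Qed.

Lemma hprod_setT_comm h a : clifford_system h ->
  hprod h eT * h a = h a * hprod h eT.
Proof.
move=> hs; rewrite hprod_comm1 // -signr_odd.
suff /negPf -> : ~~ odd #|(eT :\ a)%SET| by rewrite scale1r.
by move: n_odd; rewrite -[X in odd X]card_ord -cardsT (cardsD1 a) inE.
Qed.

Lemma commute_prod (X : Cl) h A :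
  (forall a, X * h a = h a * X) -> X * hprod h A = hprod h A * X.
Proof.
by move=> Xh; apply: commr_prod => a _; exact: Xh.
Qed.

Lemma central_gen (X : Cl) :
  (forall a, X * cl_gen a = cl_gen a * X) -> central X.
Proof.
move=> Xg u; rewrite [u]cl_coordE mulr_sumr mulr_suml; apply: eq_bigr => A _.
by rewrite -scalerAr -scalerAl -hprod_gen commute_prod.
Qed.

Lemma central_top : central cl_top.
Proof.
apply: central_gen => a; rewrite cl_top_hprod hprod_setT_comm //.
exact: cl_gen_system.
Qed.

Lemma central_pair a b : central (cl_pair a b).
Proof.
move=> u; rewrite mulrDl mulrDr -!scalerAl -!scalerAr mul1r mulr1.
by rewrite central_top.
Qed.

Lemma cl_top_sq : cl_top * cl_top = s%:A :> Cl.
Proof.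
by rewrite cl_top_hprod hprod_sq //; exact: cl_gen_system.
Qed.

Lemma cl_pairM a b c d :
  cl_pair a b * cl_pair c d = cl_pair (a * c + s * (b * d)) (a * d + b * c).
Proof.
set w := RHS; rewrite /cl_pair mulrDl !mulrDr -!scalerAl -!scalerAr.
rewrite !mul1r mulr1.
rewrite cl_top_sq; apply: clP => A; rewrite !(cl_coordD, cl_coordZ); ring.
Qed.

(** Conjugation by [h a] preserves the trace, while anticommutation makes it reverse the sign of
    [u]. *)
Lemma tau_anti h a (u : Cl) : clifford_system h ->
  u * h a = - (h a * u) -> cl_coord u e0 = 0.
Proof.
move=> hs uh; have hh := system_sq two_neq0 hs a.
have : cl_coord (u * h a * h a) e0 = - cl_coord (h a * h a * u) e0.
  by rewrite tauC uh mulrN mulrA -scaleN1r cl_coordZ mulN1r.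
rewrite -mulrA hh -scalerAr -scalerAl mul1r mulr1 cl_coordZ => /eqP.
rewrite -subr_eq0 opprK -mulr2n -mulr_natl !mulf_eq0 (negPf two_neq0) /=.
case/orP => [/eqP e_0|/eqP//].
by have := @eta_sq R p q a; rewrite e_0 mul0r => /eqP; rewrite eq_sym oner_eq0.
Qed.

Lemma coord_tau A (u : Cl) :
  cl_coord u A = cl_sign R A A * cl_coord (cl_basis R A * u) e0.
Proof. by rewrite tau_basis mulrA cl_sign_sqr mul1r. Qed.

(** Take [a] outside [A] if [#|A|] is odd and inside it otherwise; by [hprod_comm1], [h a] then
    anticommutes with [hprod h A]. *)
Lemma odd_setD1 A : A != e0 -> A != eT ->
  exists a, odd #|(A :\ a)%SET|.
Proof.
move=> A0 AT; case: (boolP (odd #|A|)) => oA.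
  have [a aA] : exists a, a \notin A.
    apply/existsP; apply: contraNT AT => /existsPn aA.
    by apply/eqP/setP => a; rewrite inE; have := aA a; rewrite negbK.
  by exists a; move: oA; rewrite (cardsD1 a) (negPf aA).
have [E|[a aA]] := set_0Vmem A; first by rewrite E eqxx in A0.
by exists a; move: oA; rewrite (cardsD1 a) aA /= negbK.
Qed.

Lemma hprod_anti h A : clifford_system h ->
  A != e0 -> A != eT -> exists a, hprod h A * h a = - (h a * hprod h A).
Proof.
move=> hs A0 AT; have [a oA] := odd_setD1 A0 AT.
by exists a; rewrite hprod_comm1 // -signr_odd oA scaleN1r.
Qed.

Lemma tau_hprod h A (c : Cl) : clifford_system h ->
  central c -> A != e0 -> A != eT -> cl_coord (c * hprod h A) e0 = 0.
Proof.
move=> hs cc A0 AT; have [a ha] := hprod_anti hs A0 AT.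
by apply: (tau_anti (a := a) hs); rewrite -mulrA ha mulrN mulrA -cc mulrA.
Qed.

Lemma coordT_tau (u : Cl) : cl_coord u eT = s * cl_coord (cl_top * u) e0.
Proof. by rewrite coord_tau cl_topE. Qed.

(** Each coordinate is, up to sign, a trace against a basis element, and [tau_hprod] kills it away
    from [e0] and [eT]. *)
Lemma central_cl_pair (X : Cl) : central X ->
  X = cl_pair (cl_coord X e0) (cl_coord X eT).
Proof.
move=> cX; apply: clP => A.
have [->|A0] := eqVneq A e0; first by rewrite cl_pair_coord0.
have [->|AT] := eqVneq A eT; first by rewrite cl_pair_coordT.
have gs := @cl_gen_system R p q.
have H (c : Cl) : central c -> cl_coord c A = 0.
  by move=> cc; rewrite coord_tau -hprod_gen -cc tau_hprod // mulr0.
by rewrite !H //; exact: central_pair.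
Qed.

(** * Expansion in even products with central coefficients *)

Lemma card_setC_odd A : odd #|(~: A)%SET| = ~~ odd #|A|.
Proof.
have := cardsC A; rewrite card_ord => /(congr1 odd); rewrite oddD n_odd.
by case: (odd #|A|); case: (odd _).
Qed.

Lemma tau_hprod2 h A B (c : Cl) : clifford_system h -> central c ->
  ~~ odd #|A| -> ~~ odd #|B| ->
  cl_coord (c * (hprod h B * hprod h A)) e0
  = (A == B)%:R * cl_sign R B B * cl_coord c e0.
Proof.
move=> hs cc eA eB; have [->|AB] := eqVneq A B.
  by rewrite hprod_sq // -scalerAr mulr1 cl_coordZ mul1r.
rewrite hprodM // -scalerAr cl_coordZ tau_hprod ?mulr0 ?mul0r //.
  apply: contra AB => /eqP E; rewrite -[A](setsymK B) E.
  by rewrite setsym0.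
(* Complementary sets have opposite parities, the number of generators being odd. *)
apply/eqP => E; have AE : A = (~: B)%SET.
  by apply/setP => i; have := congr1 (fun C : {set _} => i \in C) E;
    rewrite !inE; case: (i \in A); case: (i \in B).
by move: eA; rewrite AE card_setC_odd eB.
Qed.

(* For odd [A], the coordinate of [u] at [A] is the coefficient of [cl_top] in
   front of [hprod h (~: A)]. *)
Definition hexpand (h : 'I_(p + q) -> Cl) (u : Cl) : Cl :=
  \sum_(A : {set 'I_(p + q)} | ~~ odd #|A|)
    cl_pair (cl_coord u A) (cl_coord u (~: A)%SET) * hprod h A.

Lemma tau_hexpand h u c B : clifford_system h -> central c ->
  ~~ odd #|B| ->
  cl_coord (c * hprod h B * hexpand h u) e0 =
  cl_sign R B B *
    cl_coord (c * cl_pair (cl_coord u B) (cl_coord u (~: B)%SET)) e0.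
Proof.
move=> hs cc eB; rewrite mulr_sumr cl_coord_sum (bigD1 B) //= big1 => [|A].
  rewrite addr0 mulrA -[c * _ * _]mulrA -central_pair [c * _]mulrA -mulrA.
  by rewrite tau_hprod2 ?eqxx ?mul1r // => v;
    rewrite -mulrA central_pair !mulrA cc.
move=> /andP[eA AB].
rewrite mulrA -[c * _ * _]mulrA -central_pair [c * _]mulrA -mulrA.
rewrite tau_hprod2 ?(negPf AB) ?mul0r // => v.
by rewrite -mulrA central_pair !mulrA cc.
Qed.

(** By [tau_hexpand], traces against [c * hprod h B] isolate the coefficient at [B]; [c = 1] and
    [c = cl_top] read off its two coordinates. Odd sets are covered as complements of even ones. *)
Lemma hexpand_eq0 h u : clifford_system h -> hexpand h u = 0 -> u = 0.
Proof.
move=> hs u0.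
have ev B : ~~ odd #|B| ->
    cl_coord u B = 0 /\ cl_coord u (~: B)%SET = 0.
  move=> eB; have H c : central c ->
      cl_coord (c * cl_pair (cl_coord u B) (cl_coord u (~: B)%SET)) e0 = 0.
    move=> cc; have := tau_hexpand u hs cc eB.
    rewrite u0 mulr0 => /(congr1 ( *%R (cl_sign R B B))).
    by rewrite mulrA cl_sign_sqr mul1r => <-; rewrite {1}/cl_coord ffunE mulr0.
  split; first by have := H _ (central_pair 1 0);
    rewrite cl_pairM cl_pair_coord0 mul0r mulr0 addr0 mul1r.
  have := H _ (central_pair 0 1).
  rewrite cl_pairM cl_pair_coord0 mul0r add0r mul1r.
  by move=> /(congr1 ( *%R s)); rewrite mulrA cl_sign_sqr mul1r mulr0.
apply: clP => A; rewrite [in RHS]/cl_coord ffunE.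
case: (boolP (odd #|A|)) => oA; last by have [] := ev _ oA.
by have := ev (~: A)%SET; rewrite card_setC_odd oA finset.setCK => /(_ isT)[].
Qed.

Lemma cl_pairD a b c d : cl_pair (a + c) (b + d) = cl_pair a b + cl_pair c d.
Proof. by rewrite /cl_pair !scalerDl addrACA. Qed.

Lemma cl_pairZ k a b : k *: cl_pair a b = cl_pair (k * a) (k * b).
Proof. by rewrite /cl_pair scalerDr !scalerA. Qed.

Lemma hexpand_linear h : linear (hexpand h).
Proof.
move=> a u v; rewrite /hexpand scaler_sumr -big_split /=.
apply: eq_bigr => A _.
by rewrite !(cl_coordD, cl_coordZ) cl_pairD -cl_pairZ mulrDl scalerAl.
Qed.

(** An injective endomorphism of a finite-dimensional space is onto. *)
Lemma hexpand_surj h X : clifford_system h -> exists u, X = hexpand h u.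
Proof.
move=> hs.
pose lin := GRing.isLinear.Build R Cl Cl _ (hexpand h) (hexpand_linear h).
pose f : {linear Cl -> Cl} := HB.pack (hexpand h) lin.
have ker0 : lker (linfun f) == 0%VS.
  rewrite -subv0; apply/subvP => u; rewrite memv_ker lfunE /= => /eqP.
  by move=> /(hexpand_eq0 hs) ->; exact: mem0v.
have := memvf X; rewrite -(lker0_limgf ker0) => /memv_imgP[u _ ->].
by exists u; rewrite lfunE.
Qed.

(** Any [Y] expands in the products [hprod h A] with central coefficients, and [X] commutes with
    both. *)
Lemma commutant_system h X : clifford_system h ->
  (forall a, X * h a = h a * X) -> central X.
Proof.
move=> hs Xh Y; have [u ->] := hexpand_surj Y hs.
rewrite mulr_sumr mulr_suml; apply: eq_bigr => A _.
by rewrite mulrA -central_pair -!mulrA commute_prod.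
Qed.

Lemma central_hprodT h : clifford_system h -> central (hprod h eT).
Proof.
by move=> hs; apply: (commutant_system hs) => a; exact: hprod_setT_comm.
Qed.

(** * Averages intertwining two systems *)

(* [cl_sign R A A *: hprod g A] is the inverse of [hprod g A]. *)
Definition twist (h g : 'I_(p + q) -> Cl) (F : Cl) : Cl :=
  \sum_A cl_sign R A A *: (hprod h A * F * hprod g A).

Lemma twistD h g F K : twist h g (F + K) = twist h g F + twist h g K.
Proof.
rewrite /twist -big_split; apply: eq_bigr => A _ /=.
by rewrite mulrDr mulrDl scalerDr.
Qed.

Lemma twistMl h g c F : central c -> twist h g (c * F) = c * twist h g F.
Proof.
move=> cc; rewrite /twist mulr_sumr; apply: eq_bigr => A _.
by rewrite mulrA -cc -!mulrA scalerAr.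
Qed.

(** Replacing [A] by [setsym [set a] A] on the left matches the summands of both sides; the signs
    agree since every value of [cl_sign] squares to 1. *)
Lemma twist_comm h g F a : clifford_system h -> clifford_system g ->
  h a * twist h g F = twist h g F * g a.
Proof.
move=> hs gs; rewrite /twist mulr_sumr mulr_suml.
rewrite (reindex_inj (can_inj (setsymK [set a]%SET))).
apply: eq_bigr => A _; set A' := setsym _ _.
have L : h a * hprod h A' = cl_sign R [set a]%SET A' *: hprod h A.
  by rewrite hprod_mull // setsymK.
have Rg : hprod g A * g a = cl_sign R A [set a]%SET *: hprod g A'.
  by rewrite -hprod1 hprodM // setsymC.
rewrite -scalerAr -scalerAl -[_ * g a]mulrA Rg !mulrA L -!scalerAl -scalerAr.
rewrite !scalerA; congr (_ *: _).
rewrite !(cl_sign_symr, cl_sign_syml).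
set x := cl_sign _ [set a]%SET [set a]%SET; set y := cl_sign _ [set a]%SET A.
have xx : x * x = 1 by exact: cl_sign_sqr.
have yy : y * y = 1 by exact: cl_sign_sqr.
by rewrite -[RHS]mul1r -xx -[RHS]mul1r -yy; ring.
Qed.

Lemma hprod_intertwine h g X A : (forall a, h a * X = X * g a) ->
  hprod h A * X = X * hprod g A.
Proof.
move=> hX; rewrite /hprod; elim/big_rec2: _ => [|a x y _ IH].
  by rewrite mul1r mulr1.
by rewrite -mulrA IH mulrA hX mulrA.
Qed.

Lemma tau_twist h c F : clifford_system h -> central c ->
  cl_coord (c * twist h h F) e0 = #|{set 'I_(p + q)}|%:R * cl_coord (c * F) e0.
Proof.
move=> hs cc; rewrite mulr_sumr cl_coord_sum -sumr_const mulr_suml.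
apply: eq_bigr => A _; rewrite mul1r -scalerAr cl_coordZ mulrA.
rewrite [cl_coord (_ * hprod h A) _]tauC [hprod h A * _]mulrA -cc -mulrA.
rewrite [hprod h A * (_ * _)]mulrA hprod_sq //.
by rewrite -scalerAl -scalerAr mul1r cl_coordZ mulrA cl_sign_sqr mul1r.
Qed.

Lemma central_twist h F : clifford_system h -> central (twist h h F).
Proof.
by move=> hs; apply: (commutant_system hs) => a; rewrite twist_comm.
Qed.

(** Up to the factor [2^n], averaging a system against itself projects onto the center, so the
    traces against [1] and [cl_top] determine the result. *)
Lemma twist_self h F : clifford_system h -> twist h h F =
  #|{set 'I_(p + q)}|%:R *: cl_pair (cl_coord F e0) (cl_coord F eT).
Proof.
move=> hs; rewrite (central_cl_pair (central_twist F hs)) cl_pairZ.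
have c1 : central 1 by move=> u; rewrite mul1r mulr1.
congr cl_pair; first by rewrite -[twist _ _ _]mul1r tau_twist // mul1r.
by rewrite !coordT_tau (tau_twist _ hs central_top) mulrCA.
Qed.

(** Since [twist g h K] intertwines [g] with [h], it passes through each [hprod g A] into the
    argument of the average. *)
Lemma twistM h g F K : clifford_system h -> clifford_system g ->
  twist h g F * twist g h K = twist h h (F * twist g h K).
Proof.
move=> hs gs; rewrite {1}/twist mulr_suml; apply: eq_bigr => A _.
rewrite -scalerAl -[_ * _ * twist g h K]mulrA; congr (_ *: _).
rewrite (@hprod_intertwine g h) ?mulrA // => a.
exact: twist_comm.
Qed.

(** Exchanging the sums turns the inner one into the average of [hprod g A] over the generators, a
    central projection. Only [A = e0] and [A = eT] survive, each contributing [2^n]; the second uses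
    the equality of the top products. *)
Lemma sum_twist_basis h g : clifford_system h -> clifford_system g ->
  hprod h eT = hprod g eT ->
  \sum_B cl_sign R B B *: (twist h g (cl_basis R B) * cl_basis R B)
  = (2 * #|{set 'I_(p + q)}|%:R)%:A.
Proof.
move=> hs gs hg.
have -> : \sum_B cl_sign R B B *: (twist h g (cl_basis R B) * cl_basis R B)
  = \sum_A cl_sign R A A *: (hprod h A * twist cl_gen cl_gen (hprod g A)).
  under eq_bigr do rewrite mulr_suml scaler_sumr.
  rewrite exchange_big /=; apply: eq_bigr => A _.
  rewrite mulr_sumr scaler_sumr; apply: eq_bigr => B _.
  rewrite -scalerAl -scalerAr !scalerA [X in X *: _]mulrC !hprod_gen.
  by rewrite !mulrA.
under eq_bigr do rewrite (twist_self _ (@cl_gen_system R p q)).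
rewrite (bigD1 e0) //= (bigD1 eT) /=; last by rewrite setT_neq0.
rewrite big1 ?addr0 => [|A /andP[A0 AT]]; last first.
  have c1 : central 1 by move=> u; rewrite mul1r mulr1.
  have := tau_hprod gs c1 A0 AT; rewrite mul1r coordT_tau => ->.
  rewrite (tau_hprod gs central_top A0 AT) mulr0 cl_pairZ mulr0.
  by rewrite /cl_pair !scale0r addr0 mulr0 scaler0.
rewrite -(central_cl_pair (central_hprodT gs)) hg !hprod0 cl_sign0l.
rewrite -!scalerAr hprod_sq //. rewrite !scale1r mul1r !scalerA.
rewrite tau1 coordT_tau mulr1 tau_top mulr0 /cl_pair scale0r addr0.
rewrite scale1r -scalerDl; congr (_ *: _).
by rewrite [s * _]mulrC -mulrA cl_sign_sqr mulr1 mulr_natl.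
Qed.

Lemma twist_nonzero h g c : clifford_system h -> clifford_system g ->
  hprod h eT = hprod g eT -> central c -> c != 0 ->
  exists F K, c * (twist h g F * twist g h K) != 0.
Proof.
move=> hs gs hg cc c0.
have N0 : #|{set 'I_(p + q)}|%:R != 0 :> R.
  by rewrite pnatr_eq0 -lt0n; apply/card_gt0P; exists e0.
(* Otherwise [c] would annihilate the nonzero scalar of [sum_twist_basis]. *)
have [B QB] : exists B, c * twist g h (cl_basis R B) != 0.
  apply/existsP; apply: contraNT c0 => /existsPn Q0.
  have := congr1 ( *%R c) (sum_twist_basis gs hs (esym hg)).
  rewrite mulr_sumr big1 => [/esym/eqP|B _]; last first.
    have := Q0 B; rewrite negbK => /eqP cQ.
    by rewrite -scalerAr mulrA cQ mul0r scaler0.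
  by rewrite -scalerAr mulr1 scaler_eq0 mulf_eq0 (negPf two_neq0) (negPf N0).
have [C QC] : exists C, cl_coord (c * twist g h (cl_basis R B)) C != 0.
  apply/existsP; apply: contraNT QB => /existsPn Q0; apply/eqP/clP => C.
  by have := Q0 C; rewrite negbK => /eqP ->; rewrite /cl_coord ffunE.
(* The trace of [cl_basis R C * u] is, up to sign, the coordinate of [u] at [C], so the product has
   nonzero trace. *)
exists (cl_basis R C), (cl_basis R B).
rewrite twistM // -twistMl // mulrA cc -mulrA twist_self //.
apply: contra QC => /eqP /(congr1 (fun u => cl_coord u e0)).
rewrite cl_coordZ cl_pair_coord0 tau_basis [RHS]/cl_coord ffunE => /eqP.
rewrite !mulf_eq0 (negPf N0) /= => /orP[/eqP sC|//].
have := @cl_sign_sqr R p q C C; rewrite sC mul0r => /eqP.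
by rewrite eq_sym oner_eq0.
Qed.

Lemma cl_pair00 : cl_pair 0 0 = 0.
Proof. by rewrite /cl_pair !scale0r addr0. Qed.

Lemma cl_pair10 : cl_pair 1 0 = 1.
Proof. by rewrite /cl_pair scale1r scale0r addr0. Qed.

(** Glues solutions found separately in two complementary factors; the cross terms vanish because
    [e1 * e2 = 0]. *)
Lemma twist_idempotents h g e1 e2 F1 K1 F2 K2 :
  central e1 -> central e2 -> e1 * e1 = e1 -> e2 * e2 = e2 -> e1 * e2 = 0 ->
  e1 + e2 = 1 -> e1 * (twist h g F1 * twist g h K1) = e1 ->
  e2 * (twist h g F2 * twist g h K2) = e2 ->
  exists F K, twist h g F * twist g h K = 1.
Proof.
move=> c1 c2 e11 e22 e12 e1D2 E1 E2.
have e21 : e2 * e1 = 0 by rewrite c2.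
have cM (c d X Y : Cl) : central d -> (c * X) * (d * Y) = c * d * (X * Y).
  by move=> cd; rewrite mulrA -[c * X * d]mulrA -cd !mulrA.
exists (e1 * F1 + e2 * F2), (e1 * K1 + e2 * K2).
rewrite !twistD !twistMl // mulrDl !mulrDr.
rewrite (cM e1 e1) // (cM e1 e2) // (cM e2 e1) // (cM e2 e2) //.
rewrite e11 e22 e12 e21.
by rewrite !mul0r addr0 add0r E1 E2.
Qed.

Lemma pauli h g : clifford_system h -> clifford_system g ->
  hprod h eT = hprod g eT -> exists F K, twist h g F * twist g h K = 1.
Proof.
move=> hs gs hg.
have pairPQ F K : exists a b, twist h g F * twist g h K = cl_pair a b.
  by rewrite twistM // (central_cl_pair (central_twist _ hs)); do 2!eexists.
have /eqP : s * s = 1 by exact: cl_sign_sqr.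
rewrite -expr2 sqrf_eq1 => /orP[]/eqP sE.
  (* Here [cl_top] squares to 1, and [eps 1], [eps (-1)] are the central idempotents splitting the
     algebra into two factors. *)
  pose eps (k : R) := cl_pair 2^-1 (k / 2).
  have half k : k * k = 1 -> exists F K,
      eps k * (twist h g F * twist g h K) = eps k.
    move=> kk; have [||F [K]] := @twist_nonzero h g (eps k) hs gs hg.
    - exact: central_pair.
    - apply/eqP => /(congr1 (fun u => cl_coord u e0)).
      rewrite cl_pair_coord0 [RHS]/cl_coord ffunE => /eqP.
      by rewrite invr_eq0 (negPf two_neq0).
    have [a [b PQ]] := pairPQ F K.
    (* On the factor of [eps k], [cl_top] acts as the scalar [k], so central elements become
       scalars. *)
    have epsE : eps k * cl_pair a b = (a + k * b) *: eps k.
      rewrite /eps cl_pairM sE cl_pairZ; congr cl_pair; first ring.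
      by rewrite -[2^-1 * b]mul1r -kk; ring.
    rewrite PQ epsE scaler_eq0 negb_or => /andP[m0 _].
    exists F, (cl_pair (a + k * b)^-1 0 * K).
    rewrite [twist g h _]twistMl; last exact: central_pair.
    rewrite [twist h g F * _]mulrA -(central_pair _ _ (twist h g F)).
    rewrite -mulrA mulrA -(central_pair _ _ (eps k)) -mulrA PQ epsE.
    rewrite /cl_pair scale0r addr0 -scalerAl mul1r scalerA mulVf //.
    by rewrite scale1r.
  have [F1 [K1 E1]] := half 1 (mulr1 1).
  have [|F2 [K2 E2]] := half (-1); first by rewrite mulrNN mulr1.
  have c1 : central (eps 1) by exact: central_pair.
  have c2 : central (eps (-1)) by exact: central_pair.
  have e12 : eps 1 * eps (-1) = 0.
    rewrite /eps cl_pairM sE -[RHS]cl_pair00; congr cl_pair; ring.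
  have e11 : eps 1 * eps 1 = eps 1.
    by rewrite /eps cl_pairM sE; congr cl_pair; field.
  have e22 : eps (-1) * eps (-1) = eps (-1).
    by rewrite /eps cl_pairM sE; congr cl_pair; field.
  have e1D2 : eps 1 + eps (-1) = 1.
    by rewrite /eps -cl_pairD -cl_pair10; congr cl_pair; field.
  exact: (twist_idempotents c1 c2 e11 e22 e12 e1D2 E1 E2).
(* Here [cl_top] squares to -1 and the center is a field: a nonzero element is inverted by its
   conjugate over [a ^+ 2 + b ^+ 2]. *)
have c1 : central 1 by move=> u; rewrite mul1r mulr1.
have [F [K]] := twist_nonzero hs gs hg c1 (oner_neq0 _).
rewrite mul1r; have [a [b PQ]] := pairPQ F K; rewrite PQ => ab0.
have m0 : a ^+ 2 + b ^+ 2 != 0.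
  rewrite paddr_eq0 ?sqr_ge0 // !sqrf_eq0; apply: contra ab0.
  by move=> /andP[/eqP-> /eqP->]; rewrite /cl_pair !scale0r addr0.
exists F, (cl_pair (a / (a ^+ 2 + b ^+ 2)) (- b / (a ^+ 2 + b ^+ 2)) * K).
rewrite [twist g h _]twistMl; last exact: central_pair.
rewrite mulrA -(central_pair _ _ (twist h g F)) -mulrA PQ cl_pairM sE.
by rewrite -cl_pair10; congr cl_pair; field.
Qed.

Lemma cl_pair_conj a b : cl_pair a b * cl_pair a (- b) =
  (a ^+ 2 - s * b ^+ 2)%:A.
Proof.
rewrite cl_pairM -[RHS]mulr1 -scalerAl mul1r -cl_pair10 cl_pairZ mulr1 mulr0.
by congr cl_pair; ring.
Qed.

(** * The ratio of two top products *)

Lemma central_sqr1 c : central c -> c * c = 1 ->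
  [\/ c = 1, c = -1, c = cl_top /\ s = 1 | c = - cl_top /\ s = 1].
Proof.
move=> /central_cl_pair; set a := cl_coord c e0; set b := cl_coord c eT.
move=> ->; rewrite cl_pairM -[X in _ = X -> _]cl_pair10 => E.
have := congr1 (fun u => cl_coord u e0) E; rewrite /= !cl_pair_coord0.
have := congr1 (fun u => cl_coord u eT) E; rewrite /= !cl_pair_coordT.
(* In coordinates, [c * c = 1] reads [2ab = 0] and [a^2 + s b^2 = 1]; with [a = 0] this is solvable
   only for [s = 1]. *)
move=> ab1; have /eqP : a * b = 0 by lra.
rewrite mulf_eq0 => /orP[]/eqP -> /eqP; last first.
  rewrite !mulr0 addr0 -expr2 sqrf_eq1 => /orP[]/eqP ->.
    by apply: Or41; rewrite cl_pair10.
  by apply: Or42; rewrite /cl_pair scale0r addr0 scaleN1r.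
rewrite mulr0 add0r => /eqP sb.
have /eqP : s * s = 1 by exact: cl_sign_sqr.
rewrite -expr2 sqrf_eq1 => /orP[]/eqP sE; last first.
  have := sqr_ge0 b; rewrite expr2 => b2; exfalso; rewrite sE in sb.
  by clear E ab1; lra.
move: sb; rewrite sE mul1r => /eqP; rewrite -expr2 sqrf_eq1.
case/orP => /eqP ->; rewrite /cl_pair scale0r add0r.
  by apply: Or43; rewrite scale1r.
by apply: Or44; rewrite scaleN1r.
Qed.

Lemma top_ratio h g : clifford_system h -> clifford_system g ->
  exists c, [/\ central c, c * c = 1 & hprod h eT = c * hprod g eT].
Proof.
move=> hs gs; have ch := central_hprodT hs; have cg := central_hprodT gs.
have hh := hprod_sq two_neq0 hs eT; have gg := hprod_sq two_neq0 gs eT.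
have ss : s * s = 1 by exact: cl_sign_sqr.
(* Both top products square to [s%:A], so [s *: hprod g eT] is the inverse of [hprod g eT]. *)
exists (s *: (hprod h eT * hprod g eT)); split.
- by move=> u; rewrite -scalerAl -scalerAr -mulrA cg !mulrA ch.
- rewrite -scalerAl -scalerAr scalerA ss scale1r.
  rewrite -mulrA [X in _ * X]mulrA (cg (hprod h eT)) -[X in _ * X]mulrA gg.
  by rewrite -!scalerAr mulr1 hh scalerA ss scale1r.
- by rewrite -scalerAl -mulrA gg -scalerAr mulr1 scalerA ss scale1r.
Qed.

(** Compared with the generators, the top product is [cl_top] or [1] up to sign. This discreteness
    forces constancy on a connected domain. *)
Lemma hprodT_coord h A : clifford_system h ->
  cl_coord (hprod h eT) A \in [:: -1; 0; 1].
Proof.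
move=> hs; have cg := central_hprodT (@cl_gen_system R p q).
have [c [cc c1 ->]] := top_ratio hs (@cl_gen_system R p q).
rewrite -cl_top_hprod.
have tt := cl_top_sq; have b (B : bool) : B%:R \in [:: -1; 0; 1 : R].
  by case: B; rewrite !inE eqxx ?orbT.
have bN (B : bool) : - B%:R \in [:: -1; 0; 1 : R].
  by case: B; rewrite !inE ?oppr0 eqxx ?orbT.
case: (central_sqr1 cc c1) => [->|->|[-> sE]|[-> sE]].
- by rewrite mul1r cl_topE cl_coord_basis.
- by rewrite mulN1r -scaleN1r cl_coordZ mulN1r cl_topE cl_coord_basis.
- by rewrite tt sE scale1r cl_coord_basis.
- by rewrite mulNr tt sE scale1r -scaleN1r cl_coordZ mulN1r cl_coord_basis.
Qed.

Lemma central_exp_odd (c : Cl) m : c * c = 1 -> odd m -> c ^+ m = c.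
Proof.
move=> c1 om; rewrite -(odd_double_half m) om exprD expr1.
by rewrite -mul2n exprM expr2 c1 expr1n mulr1.
Qed.

Lemma hprodT_central (c : Cl) h : central c -> c * c = 1 ->
  hprod (fun a => c * h a) eT = c * hprod h eT.
Proof.
move=> cc c1; rewrite /hprod prodrMl_comm => [|a _]; last exact: cc.
by rewrite cardsT card_ord central_exp_odd.
Qed.

Lemma system_central (c : Cl) h : central c -> c * c = 1 ->
  clifford_system h -> clifford_system (fun a => c * h a).
Proof.
move=> cc c1 hs a b.
have E X Y : c * X * (c * Y) = X * Y.
  by rewrite mulrA -[c * X * c]mulrA -cc mulrA c1 mul1r.
by rewrite !E.
Qed.

Lemma tau_central_mulC c X Y : central c ->
  cl_coord (c * (X * Y)) e0 = cl_coord (c * (Y * X)) e0.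
Proof. by move=> cc; rewrite (mulrA c Y) (cc Y) -mulrA [RHS]tauC -mulrA. Qed.

(** Both products are central, hence determined by their traces against [1] and [cl_top], which do
    not see the order of the factors. *)
Lemma twist_mulC h g F K : clifford_system h -> clifford_system g ->
  twist h g F * twist g h K = twist g h K * twist h g F.
Proof.
move=> hs gs; have ch := central_twist (F * twist g h K) hs.
have cg := central_twist (K * twist h g F) gs.
rewrite -twistM // in ch; rewrite -twistM // in cg.
rewrite (central_cl_pair ch) (central_cl_pair cg) tauC !coordT_tau.
by rewrite (tau_central_mulC _ _ central_top).
Qed.

(** The inverse of the central element [T * Q] is its conjugate divided by its norm. The explicit
    formula later yields the regularity of [T^-1]. *)
Lemma unit_of_mul_pair (T Q : Cl) a b : T * Q = cl_pair a b ->
  Q * T = cl_pair a b -> a ^+ 2 - s * b ^+ 2 != 0 ->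
  T \is a GRing.unit /\
  T^-1 = (a ^+ 2 - s * b ^+ 2)^-1 *: (Q * cl_pair a (- b)).
Proof.
move=> TQ QT N0; set V := (_ ^-1 *: (_ * _)).
have TV : T * V = 1.
  by rewrite /V -scalerAr (mulrA T) TQ cl_pair_conj scalerA mulVf // scale1r.
have VT : V * T = 1.
  rewrite /V -scalerAl -(mulrA Q) central_pair (mulrA Q) QT.
  by rewrite cl_pair_conj scalerA mulVf // scale1r.
have uT : T \is a GRing.unit by apply/unitrP; exists V.
by split => //; rewrite -[LHS]mulr1 -TV mulrA mulVr // mul1r.
Qed.

(** * Conjugation of systems *)

Lemma conjM (T u v : Cl) : T \is a GRing.unit ->
  (T^-1 * u * T) * (T^-1 * v * T) = T^-1 * (u * v) * T.
Proof. by move=> uT; rewrite !mulrA mulrK // -!mulrA. Qed.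

Lemma conj_hprod h T A : T \is a GRing.unit ->
  hprod (fun a => T^-1 * h a * T) A = T^-1 * hprod h A * T.
Proof.
move=> uT; rewrite /hprod; elim/big_rec2: _ => [|a x y _ ->].
  by rewrite mulr1 mulVr.
by rewrite conjM.
Qed.

Lemma conj_central T u : central u -> T \is a GRing.unit -> T^-1 * u * T = u.
Proof. by move=> cu uT; rewrite -mulrA cu mulrA mulVr // mul1r. Qed.

Lemma conj_ratio h g c T : clifford_system h -> clifford_system g ->
  central c -> T \is a GRing.unit -> (forall a, g a = c * (T^-1 * h a * T)) ->
  hprod h eT = c * hprod g eT.
Proof.
move=> hs gs cc uT gE.
have n_gt0 : (0 < p + q)%N by case: (p + q)%N n_odd.
(* The squares of [g a] and [h a] are the same nonzero scalar; an index [a] exists because the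
   number of generators is odd. *)
have c1 : c * c = 1.
  pose a := Ordinal n_gt0; have := system_sq two_neq0 gs a.
  rewrite gE mulrA -[c * _ * c]mulrA -cc mulrA -mulrA conjM //.
  rewrite (system_sq two_neq0 hs) -scalerAr mulr1 -scalerAl mulVr //.
  rewrite -scalerAr mulr1 => /(congr1 (fun u => eta a a *: u)).
  by rewrite !scalerA eta_sq !scale1r.
have -> : hprod g eT = hprod (fun a => c * (T^-1 * h a * T)) eT.
  by apply: eq_bigr => a _; exact: gE.
rewrite hprodT_central // mulrA c1 mul1r conj_hprod // conj_central //.
exact: central_hprodT.
Qed.

(** The quotient commutes with every [h a], so [commutant_system] applies. *)
Lemma conj_unique h c T T' : clifford_system h -> c * c = 1 ->
  T \is a GRing.unit -> T' \is a GRing.unit ->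
  (forall a, c * (T'^-1 * h a * T') = c * (T^-1 * h a * T)) ->
  central (T' * T^-1).
Proof.
move=> hs c1 uT uT' E; apply: (commutant_system hs) => a.
have {}E : T'^-1 * h a * T' = T^-1 * h a * T.
  by rewrite -[LHS]mul1r -c1 -mulrA E mulrA c1 mul1r.
have {}E : h a * T' = T' * (T^-1 * h a * T) by rewrite -E !mulrA mulrV // mul1r.
by rewrite [RHS]mulrA E -!mulrA mulrV // mulr1.
Qed.

Lemma conj_central_mul w T u : central w -> w \is a GRing.unit ->
  T \is a GRing.unit -> (w * T)^-1 * u * (w * T) = T^-1 * u * T.
Proof.
move=> cw uw uT; rewrite invrM // mulrA -[_ * u * w]mulrA -cw.
by rewrite [_ * (w * u)]mulrA mulrVK.
Qed.

Lemma hprodT_inj h c c' : clifford_system h ->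
  c * hprod h eT = c' * hprod h eT -> c = c'.
Proof.
move=> hs /(congr1 (fun u => u * hprod h eT)) /=.
rewrite -!mulrA hprod_sq // -!scalerAr !mulr1.
move=> /(congr1 (fun u => s *: u)) /=.
by rewrite !scalerA cl_sign_sqr !scale1r.
Qed.

End Center.

(** * Functions of class C^k *)

Section ClassC.
Variables (R : realType) (r : nat).
Implicit Types (U : set 'rV[R]_r) (f : 'rV[R]_r -> R).

Lemma class_C_subset k U U' f : U' `<=` U -> class_C k U f -> class_C k U' f.
Proof.
move=> UU'; elim: k f => [|k IH] f /= [fc fd]; split => //.
- by move=> x /UU'; exact: fc.
- by move=> x /UU'; exact: fc.
- move=> i; have [d1 d2] := fd i; split; last exact: IH.
  by move=> x /UU'; exact: d1.
Qed.

Lemma class_C_continuous k U f : class_C k U f ->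
  forall x, U x -> {for x, continuous f}.
Proof. by case: k => [|k] []. Qed.

Lemma class_C_pred k U f : class_C k.+1 U f -> class_C k U f.
Proof.
elim: k f => [|k IH] f [fc fd]; first by split.
by split => // i; have [d1 d2] := fd i; split => //; exact: IH.
Qed.

(** Openness makes the functions agree near each point of [U], so limits and derivatives there
    coincide. *)
Lemma class_C_eq k U f f' : open U -> {in U, f =1 f'} ->
  class_C k U f -> class_C k U f'.
Proof.
move=> Uo; elim: k f f' => [|k IH] f f' ff' [fc fd].
all: have nff' x : U x -> {near x, f =1 f'} by move=> Ux;
  near=> y; apply: ff'; apply: mem_set; near: y; exact: open_nbhs_nbhs.
all: split => //.
- move=> x Ux; have := fc x Ux.
  rewrite /prop_for /continuous_at (ff' x (mem_set Ux)).
  apply: cvg_trans; exact: near_eq_cvg (nff' x Ux).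
- move=> x Ux; have := fc x Ux.
  rewrite /prop_for /continuous_at (ff' x (mem_set Ux)).
  apply: cvg_trans; exact: near_eq_cvg (nff' x Ux).
- move=> i; have [d1 d2] := fd i; split.
    by move=> x Ux; apply: near_eq_derivable (d1 x Ux); exact: nff'.
  apply: IH d2 => x /set_mem Ux; apply: near_eq_derive.
  exact: nff'.
Unshelve. all: by end_near. Qed.

Lemma class_C_cst k U (c : R) : class_C k U (fun=> c).
Proof.
elim: k c => [|k IH] c; split => //.
- by move=> x _; exact: cst_continuous.
- by move=> x _; exact: cst_continuous.
- move=> i; split; first by move=> x _; exact: derivable_cst.
  rewrite (_ : 'D_ _ _ = fun=> 0); first exact: IH.
  by apply/funext => x; exact: derive_cst.
Qed.

Lemma class_CD k U f f' : open U -> class_C k U f -> class_C k U f' ->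
  class_C k U (fun x => f x + f' x).
Proof.
move=> Uo; elim: k f f' => [|k IH] f f' [fc fd] [fc' fd']; split => //.
- by move=> x Ux; exact: continuousD (fc x Ux) (fc' x Ux).
- by move=> x Ux; exact: continuousD (fc x Ux) (fc' x Ux).
- move=> i; have [d1 d2] := fd i; have [d1' d2'] := fd' i; split.
    by move=> x Ux; apply: derivableD; [exact: d1|exact: d1'].
  apply: class_C_eq Uo _ (IH _ _ d2 d2') => x /set_mem Ux.
  by rewrite [RHS]deriveD //; [exact: d1|exact: d1'].
Qed.

Lemma class_CM k U f f' : open U -> class_C k U f -> class_C k U f' ->
  class_C k U (fun x => f x * f' x).
Proof.
move=> Uo; elim: k f f' => [|k IH] f f' Cf Cf'.
  move: Cf Cf' => [fc _] [fc' _]; split => // x Ux.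
  exact: continuousM (fc x Ux) (fc' x Ux).
(* The Leibniz rule also involves the undifferentiated factors, needed at the lower order. *)
have pf := class_C_pred Cf; have pf' := class_C_pred Cf'.
move: Cf Cf' => [fc fd] [fc' fd']; split.
  by move=> x Ux; exact: continuousM (fc x Ux) (fc' x Ux).
move=> i; have [d1 d2] := fd i; have [d1' d2'] := fd' i; split.
  by move=> x Ux; apply: derivableM; [exact: d1|exact: d1'].
apply: class_C_eq Uo _ (class_CD Uo (IH _ _ pf d2') (IH _ _ pf' d2)).
by move=> x /set_mem Ux; rewrite [RHS]deriveM //; [exact: d1|exact: d1'].
Qed.

Lemma class_CV k U f : open U -> (forall x, U x -> f x != 0) ->
  class_C k U f -> class_C k U (fun x => (f x)^-1).
Proof.
move=> Uo f0; elim: k => [|k IH] Cf.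
  by move: Cf => [fc _]; split => // x Ux; apply: cvgV (fc x Ux); exact: f0.
have Cp := IH (class_C_pred Cf); move: Cf => [fc fd]; split.
  by move=> x Ux; apply: cvgV (fc x Ux); exact: f0.
move=> i; have [d1 d2] := fd i; split.
  by move=> x Ux; apply: derivableV; [exact: f0|exact: d1].
(* The derivative of [f^-1] is [- f^-1 * f^-1 * f'], and [f^-1] has the lower class by induction. *)
have Cn := class_CM Uo (class_C_cst k U (-1))
  (class_CM Uo Cp (class_CM Uo Cp d2)).
apply: class_C_eq Uo _ Cn => x /set_mem Ux.
rewrite deriveV; [|exact: f0|exact: d1].
by rewrite mulN1r scaleNr mulrA -invfM -expr2.
Qed.

Lemma class_C_sum k U I (s : seq I) (P : pred I) (F : I -> 'rV[R]_r -> R) :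
  open U -> (forall i, P i -> class_C k U (F i)) ->
  class_C k U (fun x => \sum_(i <- s | P i) F i x).
Proof.
move=> Uo CF; elim: s => [|i s IH].
  apply: (class_C_eq Uo _ (class_C_cst k U 0)) => x _.
  by rewrite big_nil.
case: (boolP (P i)) => Pi.
  apply: (class_C_eq Uo _ (class_CD Uo (CF i Pi) IH)) => x _.
  by rewrite big_cons Pi.
by apply: (class_C_eq Uo _ IH) => x _; rewrite big_cons (negPf Pi).
Qed.

(** * Euclidean balls *)

Lemma eball_center (x0 : 'rV[R]_r) (eps : R) : 0 < eps -> eball x0 eps x0.
Proof.
move=> e0; rewrite /eball /= big1 ?sqrtr0 // => i _.
by rewrite subrr expr0n.
Qed.

Lemma open_eball (x0 : 'rV[R]_r) (eps : R) : open (eball x0 eps).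
Proof.
have cS : continuous (fun x : 'rV[R]_r =>
    Num.sqrt (\sum_i (x 0 i - x0 0 i) ^+ 2)).
  move=> x; apply: continuous_comp; last exact: sqrt_continuous.
  apply: (@class_C_continuous 0 setT) => //; apply: class_C_sum => [|i _].
    exact: openT.
  have Ci : class_C 0 setT (fun x : 'rV[R]_r => x 0 i - x0 0 i).
    apply: class_CD; first exact: openT.
      by split => // y _; exact: coord_continuous.
    exact: class_C_cst.
  by under eq_fun do rewrite expr2; apply: class_CM => //; exact: openT.
rewrite (_ : eball _ _ = (fun x : 'rV[R]_r =>
  Num.sqrt (\sum_i (x 0 i - x0 0 i) ^+ 2)) @^-1` [set t | t < eps]) //.
by apply: open_comp => [x _|]; [exact: cS|exact: open_lt].
Qed.

(** A sup-norm ball contains the Euclidean ball of the same radius, each coordinate being bounded by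
    the Euclidean norm. *)
Lemma eball_nbhs (x0 : 'rV[R]_r) (U : set 'rV[R]_r) : nbhs x0 U ->
  exists2 eps, 0 < eps & eball x0 eps `<=` U.
Proof.
move=> /nbhs_ballP[e /= e0 eU]; exists e => // x xe; apply: eU; split => // i j.
rewrite ord1 /ball /= distrC; apply: le_lt_trans xe.
rewrite -sqrtr_sqr ler_sqrt; last by apply: sumr_ge0 => l _; exact: sqr_ge0.
by rewrite (bigD1 j) //= lerDl; apply: sumr_ge0 => l _; exact: sqr_ge0.
Qed.

End ClassC.

(** * Local intertwiners *)

Lemma connected_sign_constant (R : realType) (V : topologicalType)
    (Omega : set V) (f : V -> R) :
  connected Omega -> (forall x, Omega x -> {for x, continuous f}) ->
  (forall x, Omega x -> f x \in [:: -1; 0; 1]) ->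
  forall x y, Omega x -> Omega y -> f x = f y.
Proof.
move=> Oc fc fv x y.
wlog fxy : x y / f x < f y => [H Ox Oy|Ox Oy].
  by case: (ltgtP (f x) (f y)) => [xy|yx|//]; [exact: H|exact/esym/H].
have fcW : {within Omega, continuous f}.
  by apply: continuous_in_subspaceT => z /set_mem; exact: fc.
have /connected_intervalP itv := connected_continuous_connected Oc fcW.
have [t Ot ft] : (f @` Omega) (f x + 2^-1).
  apply: (itv (f x) (f y)); [by exists x|by exists y|].
  by have := fv _ Ox; have := fv _ Oy; move: fxy; rewrite !inE =>
    fxy /or3P[]/eqP ? /or3P[]/eqP ?; lra.
have := fv _ Ox; have := fv _ Ot; rewrite ft !inE.
by move=> /or3P[]/eqP ? /or3P[]/eqP ?; lra.
Qed.

Section Assembly.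
Variables (R : realType) (p q r : nat).
Hypothesis n_odd : odd (p + q).
Local Notation Cl := (clifford R p q).
Local Notation V := 'rV[R]_r.
Local Notation eT := [set: 'I_(p + q)]%SET.
Local Notation s := (cl_sign R eT eT).
Implicit Types (U : set V) (h g : 'I_(p + q) -> V -> Cl) (T : V -> Cl).

(** * Algebra-valued functions of class C^k *)

Lemma cl_class_C_cst k U (c : Cl) : cl_class_C k U (fun=> c).
Proof. by move=> A; exact: class_C_cst. Qed.

Lemma cl_class_C_eq k U T T' : open U -> {in U, T =1 T'} ->
  cl_class_C k U T -> cl_class_C k U T'.
Proof.
by move=> Uo TT' CT A; apply: class_C_eq Uo _ (CT A) => x /TT' ->.
Qed.

Lemma cl_class_C_subset k U U' T : U' `<=` U ->
  cl_class_C k U T -> cl_class_C k U' T.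
Proof. by move=> UU' CT A; exact: class_C_subset (CT A). Qed.

Lemma cl_class_CZ k U f T : open U -> class_C k U f -> cl_class_C k U T ->
  cl_class_C k U (fun x => f x *: T x).
Proof.
move=> Uo Cf CT A; under eq_fun do rewrite cl_coordZ.
exact: class_CM.
Qed.

Lemma cl_class_CM k U T T' : open U -> cl_class_C k U T -> cl_class_C k U T' ->
  cl_class_C k U (fun x => T x * T' x).
Proof.
move=> Uo CT CT' C; under eq_fun do rewrite cl_coord_mul.
apply: class_C_sum => // A _; do 2?apply: class_CM => //.
exact: class_C_cst.
Qed.

Lemma cl_class_C_sum k U I (l : seq I) (P : pred I) (F : I -> V -> Cl) :
  open U -> (forall i, P i -> cl_class_C k U (F i)) ->
  cl_class_C k U (fun x => \sum_(i <- l | P i) F i x).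
Proof.
move=> Uo CF A; under eq_fun do rewrite cl_coord_sum.
by apply: class_C_sum => // i Pi; exact: CF.
Qed.

Lemma cl_class_C_hprod k U h A : open U -> (forall a, cl_class_C k U (h a)) ->
  cl_class_C k U (fun x => hprod (h^~ x) A).
Proof.
move=> Uo Ch; rewrite /hprod; elim: (index_enum _) => [|a l IH].
  apply: (cl_class_C_eq Uo _ (cl_class_C_cst k U 1)) => x _.
  by rewrite big_nil.
case: (boolP (a \in A)) => aA.
  apply: (cl_class_C_eq Uo _ (cl_class_CM Uo (Ch a) IH)) => x _.
  by rewrite big_cons aA.
by apply: (cl_class_C_eq Uo _ IH) => x _; rewrite big_cons (negPf aA).
Qed.

Lemma cl_class_C_twist k U h g F : open U ->
  (forall a, cl_class_C k U (h a)) -> (forall a, cl_class_C k U (g a)) ->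
  cl_class_C k U (fun x => twist (h^~ x) (g^~ x) F).
Proof.
move=> Uo Ch Cg; apply: cl_class_C_sum => // A _.
apply: cl_class_CZ => //; first exact: class_C_cst.
apply: cl_class_CM => //; last exact: cl_class_C_hprod.
by apply: cl_class_CM => //; [exact: cl_class_C_hprod|exact: cl_class_C_cst].
Qed.

Lemma cl_class_C_pair k U f f' : open U -> class_C k U f -> class_C k U f' ->
  cl_class_C k U (fun x => cl_pair p q (f x) (f' x)).
Proof.
move=> Uo Cf Cf' A; rewrite /cl_pair; under eq_fun do rewrite cl_coordD.
by apply: class_CD => //; apply: cl_class_CZ => //; exact: cl_class_C_cst.
Qed.

(** The class of [T^-1] is recorded too, because the uniqueness argument divides by [T]. *)
Lemma local_pauli k (Omega : set V) h g (c : Cl) x0 : open Omega ->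
  (forall a, cl_class_C k Omega (h a)) ->
  (forall a, cl_class_C k Omega (g a)) ->
  (forall x, Omega x -> clifford_system (h^~ x)) ->
  (forall x, Omega x -> clifford_system (g^~ x)) ->
  central c -> c * c = 1 ->
  (forall x, Omega x -> hprod (h^~ x) eT = c * hprod (g^~ x) eT) -> Omega x0 ->
  exists (eps : R) T, [/\ 0 < eps, eball x0 eps `<=` Omega,
    cl_class_C k (eball x0 eps) T,
    cl_class_C k (eball x0 eps) (fun x => (T x)^-1) &
    forall x, eball x0 eps x -> T x \is a GRing.unit /\
      forall a, g a x = c * ((T x)^-1 * h a x * T x)].
Proof.
move=> Oo Ch Cg hs gs cc c1 hg Ox0.
pose g' a x := c * g a x.
have Cg' a : cl_class_C k Omega (g' a).
  by apply: cl_class_CM => //; exact: cl_class_C_cst.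
have gs' x : Omega x -> clifford_system (g'^~ x).
  by move=> Ox; exact: system_central (gs _ Ox).
have hg' x : Omega x -> hprod (h^~ x) eT = hprod (g'^~ x) eT.
  by move=> Ox; rewrite hg // -hprodT_central.
(* [F] and [K] are chosen at [x0] and stay fixed while [x] varies. *)
have [F [K FK]] := pauli n_odd (hs _ Ox0) (gs' _ Ox0) (hg' _ Ox0).
pose T x := twist (h^~ x) (g'^~ x) F; pose Q x := twist (g'^~ x) (h^~ x) K.
have CT : cl_class_C k Omega T by exact: cl_class_C_twist.
have CQ : cl_class_C k Omega Q by exact: cl_class_C_twist.
have CTQ : cl_class_C k Omega (fun x => T x * Q x) by exact: cl_class_CM.
pose al x := cl_coord (T x * Q x) finset.set0.
pose be x := cl_coord (T x * Q x) eT.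
have Cal : class_C k Omega al by exact: CTQ.
have Cbe : class_C k Omega be by exact: CTQ.
have TQ x : Omega x -> T x * Q x = cl_pair p q (al x) (be x).
  move=> Ox; apply: central_cl_pair => //; rewrite /T /Q twistM //.
  - by apply: central_twist => //; exact: hs.
  - exact: hs.
  - exact: gs'.
have QT x : Omega x -> Q x * T x = cl_pair p q (al x) (be x).
  move=> Ox; rewrite -TQ // /T /Q twist_mulC //; [exact: gs'|exact: hs].
(* The norm of the central element [T x * Q x]: it is 1 at [x0], and [T x] is invertible wherever it
   is nonzero. *)
pose N x := al x ^+ 2 - s * be x ^+ 2.
have CN : class_C k Omega N.
  rewrite /N; under eq_fun do rewrite !expr2 -mulNr.
  apply: class_CD => //; first exact: class_CM.
  by apply: class_CM => //; [exact: class_C_cst|exact: class_CM].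
have N1 : N x0 = 1.
  rewrite /N /al /be [T x0 * _]FK tau1 cl_coord_basis setT_neq0 //.
  by rewrite expr1n expr0n mulr0 subr0.
have : nbhs x0 (Omega `&` [set x | N x != 0]).
  apply: filterI; first exact: open_nbhs_nbhs.
  have Nc := class_C_continuous CN Ox0.
  apply: (Nc [set t | t != 0]); apply: open_nbhs_nbhs; split; last first.
    by rewrite /= N1 oner_neq0.
  exact: open_neq.
move=> /eball_nbhs[eps eps0 epsO]; exists eps, T.
have BO : eball x0 eps `<=` Omega by move=> x /epsO[].
have Bo : open (eball x0 eps) by exact: open_eball.
have TV x : eball x0 eps x ->
    T x \is a GRing.unit /\
    (T x)^-1 = (N x)^-1 *: (Q x * cl_pair p q (al x) (- be x)).
  move=> /epsO[Ox Nx]; apply: unit_of_mul_pair => //; [exact: TQ|exact: QT].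
split => //.
- exact: cl_class_C_subset CT.
- have sub f : class_C k Omega f -> class_C k (eball x0 eps) f.
    exact: class_C_subset.
  apply: (@cl_class_C_eq k _
    (fun x => (N x)^-1 *: (Q x * cl_pair p q (al x) (- 1 * be x)))) => //.
    by move=> x /set_mem /TV[_ ->]; rewrite mulN1r.
  apply: cl_class_CZ => //.
    by apply: class_CV => //; [move=> x /epsO[]|exact: sub].
  apply: cl_class_CM => //; first exact: cl_class_C_subset CQ.
  apply: cl_class_C_pair => //; first exact: sub.
  by apply: class_CM => //; [exact: class_C_cst|exact: sub].
- move=> x Bx; have [uT _] := TV _ Bx; split => // a; have Ox := BO _ Bx.
  have := twist_comm F a (hs _ Ox) (gs' _ Ox); rewrite -/(T x) => hT.
  by rewrite -mulrA hT (mulrA (T x)^-1) mulVr // mul1r mulrA c1 mul1r.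
Qed.

(** * The four equivalences treated as one, and uniqueness of [T] *)

Definition ratio (c : Cl) : Prop :=
  [\/ c = 1, c = -1, c = cl_top | c = - cl_top].

Lemma central_ratio c : ratio c -> central c.
Proof.
have cN (u : Cl) : central u -> central (- u).
  by move=> cu v; rewrite mulNr mulrN cu.
have c1 : central (1 : Cl) by move=> u; rewrite mul1r mulr1.
by case=> ->; [|apply: cN| |apply: cN] => //; exact: central_top.
Qed.

Lemma intertwinesP k U h g (H G : Cl) T : intertwines k U h g H G T <->
  [/\ cl_class_C k U T, forall x, U x -> T x \is a GRing.unit &
    forall c, ratio c ->
      ((forall a x, U x -> g a x = c * ((T x)^-1 * h a x * T x)) <->
       H = c * G)].
Proof.
pose P c := forall a x, U x -> g a x = c * ((T x)^-1 * h a x * T x).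
have PE c (X : 'I_(p + q) -> V -> Cl) :
    (forall a x, X a x = c * ((T x)^-1 * h a x * T x)) ->
    (forall a x, U x -> g a x = X a x) = P c.
  by move=> XE; apply/propext; split => E a x Ux; rewrite E // XE.
rewrite /intertwines.
rewrite (PE 1 (fun a x => (T x)^-1 * h a x * T x)); last first.
  by move=> *; rewrite mul1r.
rewrite (PE (-1) (fun a x => - ((T x)^-1 * h a x * T x))); last first.
  by move=> *; rewrite mulN1r.
rewrite (PE cl_top (fun a x => cl_top * (T x)^-1 * h a x * T x)); last first.
  by move=> *; rewrite !mulrA.
rewrite (PE (- cl_top) (fun a x => - (cl_top * (T x)^-1 * h a x * T x)));
  last first.
  by move=> *; rewrite !mulNr !mulrA.
split=> [[CT uT [e1 e2 e3 e4]]|[CT uT e]]; split => //.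
  by move=> c [] ->; rewrite ?(mul1r G) ?(mulN1r G) ?(mulNr _ G).
split; [have := e 1|have := e (-1)|have := e cl_top|have := e (- cl_top)];
  rewrite ?(mul1r G) ?(mulN1r G) ?(mulNr _ G); apply.
- exact: Or41.
- exact: Or42.
- exact: Or43.
- exact: Or44.
Qed.

Lemma sqr1_ratio (c : Cl) : central c -> c * c = 1 -> ratio c.
Proof.
move=> cc c1; case: (central_sqr1 n_odd cc c1) => [->|->|[-> _]|[-> _]].
- exact: Or41.
- exact: Or42.
- exact: Or43.
- exact: Or44.
Qed.

(** Only the actual ratio matters: for any [c'], the conjugation identity gives [H = c' * G] by
    [conj_ratio], and this forces [c' = c] because [G] is invertible. *)
Lemma intertwines_conj k U h g (H G : Cl) c x0 T : U x0 ->
  (forall x, U x -> clifford_system (h^~ x)) ->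
  (forall x, U x -> clifford_system (g^~ x)) ->
  (forall x, U x -> hprod (h^~ x) eT = H) ->
  (forall x, U x -> hprod (g^~ x) eT = G) ->
  ratio c -> H = c * G ->
  intertwines k U h g H G T <->
  [/\ cl_class_C k U T, forall x, U x -> T x \is a GRing.unit &
    forall a x, U x -> g a x = c * ((T x)^-1 * h a x * T x)].
Proof.
move=> Ux0 hs gs hH gG rc HG; rewrite intertwinesP.
split=> -[CT uT e]; split => //.
  by rewrite (e _ rc).
move=> c' rc'; split=> [gE|HG'].
  rewrite -(hH _ Ux0) -(gG _ Ux0).
  apply: (conj_ratio n_odd (hs _ Ux0) (gs _ Ux0) (central_ratio rc')
    (uT _ Ux0)).
  by move=> a; exact: gE.
suff -> : c' = c by [].
by apply: (hprodT_inj (gs _ Ux0)); rewrite gG // -HG -HG'.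
Qed.

Lemma intertwines_scale k U h g (H G : Cl) c x0 T T' : open U -> U x0 ->
  (forall x, U x -> clifford_system (h^~ x)) ->
  (forall x, U x -> clifford_system (g^~ x)) ->
  (forall x, U x -> hprod (h^~ x) eT = H) ->
  (forall x, U x -> hprod (g^~ x) eT = G) ->
  ratio c -> c * c = 1 -> H = c * G ->
  cl_class_C k U (fun x => (T x)^-1) ->
  intertwines k U h g H G T ->
  intertwines k U h g H G T' <-> exists lambda nu : V -> R,
    [/\ class_C k U lambda, class_C k U nu,
      (forall x, U x -> lambda x *: 1 + nu x *: cl_top \is a @GRing.unit Cl) &
      forall x, U x -> T' x = (lambda x *: 1 + nu x *: cl_top) * T x].
Proof.
move=> Uo Ux0 hs gs hH gG rc c1 HG CV.
have iP S := intertwines_conj k S Ux0 hs gs hH gG rc HG.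
move=> /iP[CT uT gT]; rewrite iP.
split=> [[CT' uT' gT']|[la [nu [Cl Cn uw T'E]]]].
  have CW : cl_class_C k U (fun x => T' x * (T x)^-1) by exact: cl_class_CM.
  (* The quotient is central by [conj_unique], so these two coordinates determine it. *)
  exists (fun x => cl_coord (T' x * (T x)^-1) finset.set0).
  exists (fun x => cl_coord (T' x * (T x)^-1) eT).
  have wE x : U x -> T' x * (T x)^-1 = cl_pair p q
      (cl_coord (T' x * (T x)^-1) finset.set0)
      (cl_coord (T' x * (T x)^-1) eT).
    move=> Ux; apply: central_cl_pair => //.
    apply: (conj_unique n_odd (hs _ Ux) c1 (uT _ Ux) (uT' _ Ux)) => a.
    by rewrite -(gT a x Ux) -(gT' a x Ux).
  split; [exact: CW|exact: CW| |].
  - by move=> x Ux; rewrite -/(cl_pair p q _ _) -wE // unitrMl ?unitrV;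
      [exact: uT'|exact: uT].
  - by move=> x Ux; rewrite -/(cl_pair p q _ _) -wE // mulrVK //; exact: uT.
split.
- apply: (cl_class_C_eq Uo _ (cl_class_CM Uo (cl_class_C_pair Uo Cl Cn) CT)).
  by move=> x /set_mem Ux; rewrite T'E.
- by move=> x Ux; rewrite T'E // unitrMl ?uw //; exact: uT.
- move=> a x Ux; rewrite T'E // conj_central_mul ?gT //; last exact: uT.
  + exact: (central_pair n_odd (la x) (nu x)).
  + exact: uw.
Qed.

End Assembly.

Theorem theorem2 (R : realType) (p q r k : nat) (Omega : set 'rV[R]_r)
    (h g : 'I_(p + q) -> 'rV[R]_r -> clifford R p q)
    (n_odd : odd (p + q))
    (Omega_neq0 : Omega !=set0) (Omega_open : open Omega)
    (Omega_connected : connected Omega)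
    (h_Ck : forall a, cl_class_C k Omega (h a))
    (g_Ck : forall a, cl_class_C k Omega (g a))
    (h_rel : forall a b x, Omega x ->
       h a x * h b x + h b x * h a x = (2 * eta a b)%:A)
    (g_rel : forall a b x, Omega x ->
       g a x * g b x + g b x * g a x = (2 * eta a b)%:A) :
  exists H G : clifford R p q,
    [/\ forall x, Omega x -> \prod_(a < p + q) h a x = H,
        forall x, Omega x -> \prod_(a < p + q) g a x = G &
        forall x0, Omega x0 ->
          exists (eps : R) (T : 'rV[R]_r -> clifford R p q),
            [/\ 0 < eps, eball x0 eps `<=` Omega,
                intertwines k (eball x0 eps) h g H G T &
                forall T' : 'rV[R]_r -> clifford R p q,
                  intertwines k (eball x0 eps) h g H G T' <->
                  exists lambda nu : 'rV[R]_r -> R,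
                    [/\ class_C k (eball x0 eps) lambda,
                        class_C k (eball x0 eps) nu,
                        (forall x, eball x0 eps x ->
                           lambda x *: 1 + nu x *: cl_top
                             \is a @GRing.unit (clifford R p q)) &
                        forall x, eball x0 eps x ->
                          T' x = (lambda x *: 1 + nu x *: cl_top) * T x]]].
Proof.
have hs x : Omega x -> clifford_system (h^~ x) by move=> Ox a b; exact: h_rel.
have gs x : Omega x -> clifford_system (g^~ x) by move=> Ox a b; exact: g_rel.
(* The coordinates of the top product are continuous with values in -1, 0, 1, hence constant on the
   connected [Omega]. *)
have const f : (forall a, cl_class_C k Omega (f a)) ->
    (forall x, Omega x -> clifford_system (f^~ x)) -> forall x y, Omega x ->
    Omega y -> hprod (f^~ x) [set: 'I_(p + q)]%SET
             = hprod (f^~ y) [set: 'I_(p + q)]%SET.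
  move=> Cf fs x y Ox Oy; apply: clP => A.
  apply: (@connected_sign_constant _ _ _ (fun z => cl_coord (hprod (f^~ z) _) A)
    Omega_connected _ _ _ _ Ox Oy) => z Oz.
    exact: class_C_continuous
      (@cl_class_C_hprod _ _ _ _ _ _ _ _ Omega_open Cf A) _ Oz.
  by apply: hprodT_coord => //; exact: fs.
have [y Oy] := Omega_neq0.
pose H := hprod (h^~ y) [set: 'I_(p + q)]%SET.
pose G := hprod (g^~ y) [set: 'I_(p + q)]%SET.
have hH x : Omega x -> hprod (h^~ x) [set: 'I_(p + q)]%SET = H.
  by move=> Ox; exact: const.
have gG x : Omega x -> hprod (g^~ x) [set: 'I_(p + q)]%SET = G.
  by move=> Ox; exact: const.
(* The ratio at the single point [y] serves on all of [Omega], as [H] and [G] are constant. *)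
have [c [cc c1 HG]] := top_ratio n_odd (hs _ Oy) (gs _ Oy).
exists H, G; split=> [x Ox|x Ox|x0 Ox0].
- by rewrite -hprod_setT hH.
- by rewrite -hprod_setT gG.
have HGx x : Omega x -> hprod (h^~ x) [set: 'I_(p + q)]%SET
    = c * hprod (g^~ x) [set: 'I_(p + q)]%SET.
  by move=> Ox; rewrite hH // gG.
have [eps [T [eps0 BO CT CV TP]]] :=
  local_pauli n_odd Omega_open h_Ck g_Ck hs gs cc c1 HGx Ox0.
have Bx0 := eball_center x0 eps0.
have rc := sqr1_ratio n_odd cc c1.
have hsB x : eball x0 eps x -> clifford_system (h^~ x) by move=> /BO/hs.
have gsB x : eball x0 eps x -> clifford_system (g^~ x) by move=> /BO/gs.
have hHB x : eball x0 eps x -> hprod (h^~ x) [set: 'I_(p + q)]%SET = H.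
  by move=> /BO/hH.
have gGB x : eball x0 eps x -> hprod (g^~ x) [set: 'I_(p + q)]%SET = G.
  by move=> /BO/gG.
have TI : intertwines k (eball x0 eps) h g H G T.
  apply/(intertwines_conj n_odd k T Bx0 hsB gsB hHB gGB rc HG).
  by split => // [x Bx|a x Bx]; have [] := TP _ Bx.
exists eps, T; split => // T'.
have Bo : open (eball x0 eps) by exact: open_eball.
exact: (intertwines_scale n_odd T' Bo Bx0 hsB gsB hHB gGB rc c1 HG CV TI).
Qed.
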